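(* Let $d(t)=\sum_{n\ge 0}d_nt^n$ and $h(t)=\sum_{n\ge 0}h_nt^n$ be formal power series with real coefficients, and let $R=\mathcal{R}(d(t),h(t))$ be the Riordan array they determine. If the Hessenberg matrix \[ H=\left[\begin{array}{ccccc} d_0 & h_0 & 0 & 0 &\cdots\\ d_1 & h_1 & h_0 & 0 &\\ d_2 & h_2 & h_1 & h_0 &\\ \vdots&\vdots&&&\ddots \end{array}\right] \] (i.e., the infinite matrix whose column $0$ is $(d_0,d_1,d_2,\ldots)^T$ and whose column $j\ge 1$ is $(0,\ldots,0,h_0,h_1,h_2,\ldots)^T$ with $j-1$ leading zeros) is totally positive, then $R$ is totally positive.
   Context: An infinite matrix is called totally positive if all of its minors (of all orders) are nonnegative. For formal power series $d(t)$ and $h(t)$, the Riordan array $\mathcal{R}(d(t),h(t))=[r_{n,k}]_{n,k\ge 0}$ is the infinite matrix whose $k$th column has generating function $d(t)h(t)^k$ for each $k\ge 0$, i.e., $r_{n,k}=[t^n]\,d(t)h(t)^k$. No properness assumption ($h_0=0$, $d_0\ne 0$, $h_1\neq 0$) is imposed. *)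

(* Defs.v *)
From mathcomp Require Import all_boot all_order all_algebra.
From mathcomp Require Import reals.

Set Implicit Arguments.
Unset Strict Implicit.
Unset Printing Implicit Defensive.

Import GRing.Theory.
Local Open Scope ring_scope.

(* A formal power series is its coefficient sequence: [a n] is [t^n] a(t). *)
Definition fps (R : realType) : Type := nat -> R.

Definition fps_one (R : realType) : fps R := fun n => (n == 0%N)%:R.

Definition fps_mul (R : realType) (a b : fps R) : fps R :=
  fun n => \sum_(i < n.+1) a i * b (n - i)%N.

Definition fps_exp (R : realType) (a : fps R) (k : nat) : fps R :=
  iter k (fps_mul a) (fps_one R).

(* Infinite matrix indexed by (row, column), both starting at 0. *)
Definition infmx (R : realType) : Type := nat -> nat -> R.

Definition minor (R : realType) (M : infmx R) (k : nat) (f g : 'I_k -> nat) : R :=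
  \det (\matrix_(i < k, j < k) M (f i) (g j)).

Definition totally_positive (R : realType) (M : infmx R) : Prop :=
  forall (k : nat) (f g : 'I_k -> nat),
    (forall i j : 'I_k, (i < j)%N -> (f i < f j)%N) ->
    (forall i j : 'I_k, (i < j)%N -> (g i < g j)%N) ->
    0 <= minor M f g.

Definition riordan (R : realType) (d h : fps R) : infmx R :=
  fun n k => fps_mul d (fps_exp h k) n.

(* Column j.+1 is h shifted down by j rows; the guard is needed because
   the subtraction on nat is truncated. *)
Definition hessenberg (R : realType) (d h : fps R) : infmx R :=
  fun n k => if k is j.+1 then (if (j <= n)%N then h (n - j)%N else 0) else d n.

(* Main.v *)
Require Import Defs.
From mathcomp Require Import all_boot all_order all_algebra.
From mathcomp Require Import perm.
From mathcomp Require Import reals.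

(** Multiplication by [h] shifts the columns of [R], so [R = H (1 (+) R)], where
    [1 (+) R] is bordered by a leading 1. Since [H] is row-finite, the
    Cauchy-Binet formula applies, and the first [m + 1] columns of [R] only
    involve the first [m] columns of the [R] on the right-hand side: conclude by
    induction on [m]. *)

Set Implicit Arguments.
Unset Strict Implicit.
Unset Printing Implicit Defensive.

Import Order.TTheory GRing.Theory Num.Theory.
Local Open Scope ring_scope.

Section CauchyBinet.
Variable R : comNzRingType.

Lemma det_row_reindex (k : nat) (F : 'I_k -> 'I_k -> R) (s : 'S_k) :
  \det (\matrix_(i, j) F (s i) j) = (-1) ^+ s * \det (\matrix_(i, j) F i j).
Proof.
rewrite -det_perm -det_mulmx -row_permE; congr (\det _).
by apply/matrixP=> i j; rewrite !mxE.
Qed.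

Lemma det_col_reindex (k : nat) (F : 'I_k -> 'I_k -> R) (s : 'S_k) :
  \det (\matrix_(i, j) F i (s j)) = (-1) ^+ s * \det (\matrix_(i, j) F i j).
Proof.
rewrite -det_tr -[in RHS]det_tr.
rewrite (_ : _^T = \matrix_(i, j) F j (s i)); last first.
  by apply/matrixP=> i j; rewrite !mxE.
rewrite (det_row_reindex (fun i j => F j i)); congr (_ * \det _).
by apply/matrixP=> i j; rewrite !mxE.
Qed.

(** Each row of [A *m B] is a combination of the rows of [B]; expanding by multilinearity picks one
    row [c i] of [B] for each [i]. *)
Lemma det_mulmx_rows (k N : nat) (A : 'M[R]_(k, N)) (B : 'M[R]_(N, k)) :
  \det (A *m B) =
  \sum_(c : {ffun 'I_k -> 'I_N})
     (\prod_i A i (c i)) * \det (\matrix_(i, j) B (c i) j).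
Proof.
rewrite /determinant.
under [RHS]eq_bigr => c _ do rewrite big_distrr.
rewrite exchange_big /=; apply: eq_bigr => s _.
under eq_bigr => i _ do rewrite mxE.
rewrite bigA_distr_bigA big_distrr /=; apply: eq_bigr => c _.
rewrite big_split /= mulrCA; congr (_ * (_ * _)).
by apply: eq_bigr => i _; rewrite mxE.
Qed.

(* Summing over all maps rather than over the increasing ones costs the factor
   [k!], but the terms are still products of two minors up to a common sign. *)
Lemma Cauchy_Binet_fact (k N : nat) (A : 'M[R]_(k, N)) (B : 'M[R]_(N, k)) :
  \det (A *m B) *+ k`! =
  \sum_(c : {ffun 'I_k -> 'I_N})
     \det (\matrix_(i, j) A i (c j)) * \det (\matrix_(i, j) B (c i) j).
Proof.
under [RHS]eq_bigr => c _ do rewrite {1}/determinant big_distrl.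
rewrite exchange_big /= -card_Sn -sumr_const; apply: eq_big => // s _.
(* With the first determinant expanded over permutations, every [s] contributes the same amount,
   [\det (A *m B)]: composing [c] with [s] permutes the rows of the second determinant, which
   produces the sign of [s]. *)
have comp_bij : bijective (fun c : {ffun 'I_k -> 'I_N} =>
    [ffun i => c (s i)] : {ffun 'I_k -> 'I_N}).
  exists (fun c : {ffun 'I_k -> 'I_N} => [ffun i => c ((s^-1)%g i)]) => c;
    by apply/ffunP=> i; rewrite !ffunE ?permK ?permKV.
rewrite det_mulmx_rows (reindex _ (onW_bij _ comp_bij)) /=.
apply: eq_bigr => c _.
rewrite [X in _ * X](_ : _ = (-1) ^+ s * \det (\matrix_(i, j) B (c i) j)).
  rewrite mulrA; congr (_ * _); rewrite mulrC; congr (_ * _).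
  by apply: eq_bigr => i _; rewrite ffunE mxE.
rewrite -(det_row_reindex (fun i j => B (c i) j)); congr (\det _).
by apply/matrixP=> i j; rewrite !mxE ffunE.
Qed.

End CauchyBinet.

Lemma sorting_perm (k : nat) (c : 'I_k -> nat) :
  exists s : 'S_k, forall i j : 'I_k, (i < j)%N -> (c (s i) <= c (s j))%N.
Proof.
have /tuple_permP[s Es] : perm_eq (sort_tuple leq [tuple c i | i < k])
                                  [tuple c i | i < k].
  by rewrite /= perm_sort.
exists s => i j ltij.
have nthE (l : 'I_k) : nth 0%N (sort leq [tuple c i | i < k]) l = c (s l).
  by move: Es => /= ->; rewrite (nth_mktuple _ _ l) tnth_mktuple.
rewrite -!nthE; apply: (sorted_leq_nth leq_trans leqnn) => //.
- exact: (sort_sorted leq_total).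
- by rewrite inE size_sort size_tuple.
- by rewrite inE size_sort size_tuple.
- exact: ltnW.
Qed.

Definition increasing (k : nat) (f : 'I_k -> nat) : Prop :=
  forall i j : 'I_k, (i < j)%N -> (f i < f j)%N.

Section TotalPositivity.
Variable R : realType.

(** The hypotheses fix the rows [f] of [A] and the columns [g] of [B], so that a bound on [g]
    carries over to the minors of [B]. Among all maps [c], the non-injective ones contribute 0 and
    the injective ones can be sorted. *)
Lemma minor_mul_ge0 (A B : infmx R) (k N : nat) (f g : 'I_k -> nat) :
    (forall c, increasing c -> 0 <= minor A f c) ->
    (forall c, increasing c -> 0 <= minor B c g) ->
  0 <= minor (fun n m => \sum_(j < N) A n j * B j m) f g.
Proof.
move=> A_ge0 B_ge0.
rewrite /minor.
rewrite (_ : \matrix_(i, j) _ =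
  (\matrix_(i < k, j < N) A (f i) j) *m (\matrix_(i < N, j < k) B i (g j)));
  last by apply/matrixP=> i j; rewrite !mxE; apply: eq_bigr => l _; rewrite !mxE.
rewrite -(pmulrn_lge0 _ (fact_gt0 k)) Cauchy_Binet_fact sumr_ge0 // => c _.
have [s s_sorts] := sorting_perm (fun i => c i : nat).
rewrite (_ : (\matrix_(i, j) _) = \matrix_(i, j) A (f i) (c j)); last first.
  by apply/matrixP=> i j; rewrite !mxE.
rewrite (_ : (\matrix_(i, j) (\matrix_(_, _) _) _ _) =
             \matrix_(i, j) B (c i) (g j)); last first.
  by apply/matrixP=> i j; rewrite !mxE.
have [c_inj|/injectivePn[i [j neq_ij c_ij]]] := altP (injectiveP c); last first.
  rewrite [X in _ * X](determinant_alternate neq_ij) ?mulr0 // => l.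
  by rewrite !mxE c_ij.
have cs_incr : increasing (fun i => c (s i)).
  move=> i j lt_ij; rewrite ltn_neqAle s_sorts // andbT.
  by rewrite (inj_eq val_inj) (inj_eq c_inj) (inj_eq perm_inj) neq_ltn lt_ij.
(* Sorting [c] permutes the columns of one minor and the rows of the other by the same [s], so the
   two signs cancel. *)
have := mulr_ge0 (A_ge0 _ cs_incr) (B_ge0 _ cs_incr).
rewrite /minor (det_col_reindex (fun i j => A (f i) (c j))).
rewrite (det_row_reindex (fun i j => B (c i) (g j))).
by rewrite mulrACA -expr2 sqrr_sign mul1r.
Qed.

(* The direct sum of the [1 x 1] matrix 1 and of [M]. *)
Definition border1 (M : infmx R) : infmx R := fun n m =>
  match n, m with
  | 0%N, 0%N => 1
  | n'.+1, m'.+1 => M n' m'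
  | _, _ => 0
  end.

Lemma minor_border1S (M : infmx R) (k : nat) (f g : 'I_k -> nat) :
    (forall i, 0 < f i)%N -> (forall i, 0 < g i)%N ->
  minor (border1 M) f g = minor M (fun i => (f i).-1) (fun i => (g i).-1).
Proof.
move=> f_gt0 g_gt0; congr (\det _); apply/matrixP=> i j; rewrite !mxE.
by case: (f i) (f_gt0 i) (g j) (g_gt0 j) => // a _ [].
Qed.

Lemma increasing_pred (k : nat) (f : 'I_k -> nat) :
  (forall i, 0 < f i)%N -> increasing f -> increasing (fun i => (f i).-1).
Proof. by move=> f_gt0 f_incr i j /f_incr; case: (f i) (f_gt0 i) (f j) => // a _ []. Qed.

Lemma increasing_gt0 (k : nat) (f : 'I_k.+1 -> nat) :
  increasing f -> (0 < f ord0)%N -> forall i, (0 < f i)%N.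
Proof.
move=> f_incr f0 i; have [->//|i_neq0] := eqVneq i ord0.
by apply: (leq_ltn_trans _ (f_incr ord0 i _)); rewrite // lt0n.
Qed.

(** A minor using both row 0 and column 0 reduces by expansion to one using neither; a minor using
    just one of them has a zero row or column. Removing the border lowers column indices by one,
    whence [m] and [m.+1]. *)
Lemma minor_border1_ge0 (M : infmx R) (m : nat) :
    (forall k (f g : 'I_k -> nat), increasing f -> increasing g ->
       (forall i, g i < m)%N -> 0 <= minor M f g) ->
  forall k (f g : 'I_k -> nat), increasing f -> increasing g ->
    (forall i, g i < m.+1)%N -> 0 <= minor (border1 M) f g.
Proof.
move=> M_ge0.
have pos k (f g : 'I_k -> nat) : increasing f -> increasing g ->
    (forall i, g i < m.+1)%N -> (forall i, 0 < f i)%N -> (forall i, 0 < g i)%N ->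
    0 <= minor (border1 M) f g.
  move=> f_incr g_incr g_lt f_gt0 g_gt0; rewrite minor_border1S //.
  apply: M_ge0 => [||i]; [exact: increasing_pred..|].
  by rewrite prednK // -ltnS.
case=> [|k] f g f_incr g_incr g_lt; first by apply: pos => // -[].
case: (posnP (g ord0)) (posnP (f ord0)) => [g0|g0] [f0|f0].
- have lift_gt0 (u : 'I_k.+1 -> nat) : increasing u ->
      forall i, (0 < u (lift ord0 i))%N.
    by move=> u_incr i; apply: leq_ltn_trans (u_incr ord0 _ _).
  have lift_incr (u : 'I_k.+1 -> nat) : increasing u ->
      increasing (fun i => u (lift ord0 i)).
    by move=> u_incr i j lt_ij; apply: u_incr; rewrite !lift0.
  rewrite /minor (expand_det_col _ ord0) big_ord_recl big1 => [|i _].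
    rewrite !mxE f0 g0 mul1r addr0 /cofactor expr0 mul1r.
    have := pos _ (fun i => f (lift ord0 i)) (fun i => g (lift ord0 i))
      (lift_incr _ f_incr) (lift_incr _ g_incr) (fun i => g_lt _)
      (lift_gt0 _ f_incr) (lift_gt0 _ g_incr).
    congr (_ <= \det _); apply/matrixP=> i j; by rewrite !mxE.
  by rewrite mxE g0 -(prednK (lift_gt0 _ f_incr i)) mul0r.
- rewrite /minor (expand_det_col _ ord0) sumr_ge0 // => i _.
  by rewrite mxE g0 -(prednK (increasing_gt0 f_incr f0 i)) mul0r.
- rewrite /minor (expand_det_row _ ord0) sumr_ge0 // => i _.
  by rewrite mxE f0 -(prednK (increasing_gt0 g_incr g0 i)) mul0r.
- by apply: pos => //; apply: increasing_gt0.
Qed.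

(** Truncation to polynomials gives access to the ring laws of [{poly R}]. *)
Lemma fps_mul_coef (a b : fps R) (N n : nat) : (n < N)%N ->
  fps_mul a b n = ((\poly_(i < N) a i) * (\poly_(i < N) b i))`_n.
Proof.
move=> n_lt; have lt_N l : (l <= n)%N -> (l < N)%N by move/leq_ltn_trans; apply.
rewrite coefM; apply: eq_bigr => i _; rewrite !coef_poly.
by rewrite !lt_N ?leq_subr // -ltnS.
Qed.

(** For [d], [h] and the [m]-th power of [h], this exhibits column [m.+1] of the Riordan array as
    column [m] times [h]. *)
Lemma fps_mul_shuffle (a b c : fps R) (n : nat) :
  fps_mul a (fps_mul b c) n = fps_mul (fps_mul a c) b n.
Proof.
pose P (u : fps R) := \poly_(i < n.+1) u i.
have PE (u : fps R) (i : nat) : (i < n.+1)%N -> u i = (P u)`_i.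
  by rewrite coef_poly => ->.
transitivity (P a * (P b * P c))`_n.
  rewrite coefM; apply: eq_bigr => i _; rewrite (PE a) //.
  by rewrite (@fps_mul_coef _ _ n.+1) // ltnS leq_subr.
rewrite mulrCA mulrC coefM; apply: eq_bigr => i _.
by rewrite (PE b) ?(@fps_mul_coef _ _ n.+1) // ltnS leq_subr.
Qed.

(** Row [n] of the Hessenberg matrix vanishes beyond column [n.+1], hence the bound [n.+2]. The 1 of
    the border selects the column [d]; the shifted copies of [h] perform the convolution with
    [h]. *)
Lemma riordan_hessenberg (d h : fps R) (N n m : nat) : (n.+2 <= N)%N ->
  riordan d h n m =
  \sum_(j < N) hessenberg d h n j * border1 (riordan d h) j m.
Proof.
case: N => // N n_lt; rewrite big_ord_recl /=; case: m => [|m].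
  rewrite mulr1 big1 => [|i _]; last by rewrite mulr0.
  rewrite addr0 /riordan /fps_mul /= big_ord_recr /= subnn mulr1.
  rewrite big1 ?add0r // => i _.
  by rewrite /fps_one subn_eq0 leqNgt ltn_ord mulr0.
rewrite mulr0 add0r [LHS]fps_mul_shuffle {1}/fps_mul.
rewrite (big_ord_widen N (fun i => fps_mul d (fps_exp h m) i * h (n - i)%N)) //.
rewrite big_mkcond; apply: eq_bigr => i _; rewrite ltnS.
by case: ifP; rewrite ?mul0r // mulrC.
Qed.

End TotalPositivity.

Theorem theorem3 (R : realType) (d h : fps R) :
  totally_positive (hessenberg d h) -> totally_positive (riordan d h).
Proof.
move=> H_tp.
have R_ge0 m : forall k (f g : 'I_k -> nat), increasing f -> increasing g ->
    (forall i, g i < m)%N -> 0 <= minor (riordan d h) f g.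
  elim: m => [|m IHm] k f g f_incr g_incr g_lt.
    (* Only the empty minor, equal to 1, has all its column indices below 0. *)
    case: k f g f_incr g_incr g_lt => [|k] f g _ _ g_lt.
      by rewrite /minor det_mx00.
    by have := g_lt ord0.
  (* A single truncation that is large enough for every selected row [f i]. *)
  pose N := (\max_i f i).+2.
  have := @minor_mul_ge0 _ (hessenberg d h) (border1 (riordan d h)) k N f g.
  rewrite (_ : minor (fun n m => _) f g = minor (riordan d h) f g); last first.
    congr (\det _); apply/matrixP=> i j; rewrite !mxE -riordan_hessenberg //.
    by rewrite !ltnS (leq_bigmax i).
  apply=> c c_incr; first exact: H_tp.
  exact: (minor_border1_ge0 IHm).
move=> k f g f_incr g_incr; apply: (R_ge0 (\max_i g i).+1) => // i.
by rewrite ltnS (leq_bigmax i).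
Qed.
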